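(* There is a sample size $m=m(\varepsilon,\alpha,\beta)=\mathcal{O}\!\left(\frac1{\varepsilon^2\alpha^2}\log\frac1\beta\right)$ such that, if the sample maintained by the Optimal Bernoulli Density Estimator consists of $m$ users from $\mathcal{U}$, then for every fixed input stream $\mathcal{S}$, $$\mathbb{P}\bigl(|\tilde d-d(\mathcal{S})|\ge\alpha\bigr)\le\beta,$$ where the probability space is over the random choices of the algorithm.
   Context: Streams: $\mathcal{U}$ is a finite universe of users (with $|\mathcal{U}|\ge m$); a data stream is a finite sequence $\mathcal{S}=(s_1,\dots,s_T)$ with $s_t\in\mathcal{U}$. The density $d(\mathcal{S})$ is the number of distinct users appearing in $\mathcal{S}$ divided by $|\mathcal{U}|$. Parameters: $0<\varepsilon\le\frac12$ and accuracy parameters $\alpha,\beta\in(0,1)$; the $\mathcal{O}$ is for $\varepsilon,\alpha,\beta\to0$, and its constant does not depend on $\mathcal{U}$ or $\mathcal{S}$. Optimal Bernoulli Density Estimator (sample size $m$): sample a uniformly random subset $M\subseteq\mathcal{U}$ of $m$ users without replacement, ordered as $M[1],\dots,M[m]$; keep a bit array $\mathbf{b}=[b_1\ \dots\ b_m]$, with entries initialized independently as $b_i\sim\mathrm{Bernoulli}\bigl(\frac12(1-\tanh\frac\varepsilon2)\bigr)$. For $t=1,\dots,T$: if $s_t=M[i]$ for some $i$, re-sample $b_i\sim\mathrm{Bernoulli}\bigl(\frac12(1+\tanh\frac\varepsilon2)\bigr)$ (with fresh randomness). At the end output $$\tilde d=\frac1{\tanh(\varepsilon/2)}\Bigl(\frac1m\sum_{i=1}^m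 b_i-\frac12+\frac12\tanh\frac\varepsilon2\Bigr)+\mathrm{Laplace}\bigl(0,\tfrac1{\varepsilon m}\bigr),$$ where $\mathrm{Laplace}(0,s)$ denotes an independent random variable with density $\frac1{2s}e^{-|x|/s}$. *)

(* Defs.v *)
From HB Require Import structures.
From mathcomp Require Import all_boot all_order all_algebra.
From mathcomp Require Import all_classical all_reals all_analysis.
Set Implicit Arguments.
Unset Strict Implicit.
Unset Printing Implicit Defensive.
Import Order.TTheory GRing.Theory Num.Theory.
Import numFieldNormedType.Exports.
Local Open Scope classical_set_scope.
Local Open Scope ring_scope.

(* The filter of "(x, y, z) tends jointly to (0, 0, 0) with x, y, z > 0". *)
Definition right_of_origin {R : realType} : set_system (R * R * R) :=
  filter_prod (filter_prod (0 : R)^'+ (0 : R)^'+) (0 : R)^'+.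

Definition tanh (R : realType) (x : R) : R :=
  (expR x - expR (- x)) / (expR x + expR (- x)).

Definition laplace_pdf (R : realType) (s x : R) : R :=
  (2 * s)^-1 * expR (- `|x| / s).

Definition laplace_law d (Omega : measurableType d) (R : realType)
    (P : probability Omega R) (X : {RV P >-> R}) (s : R) : Prop :=
  forall B : set R, measurable B ->
    distribution P X B = (\int[lebesgue_measure]_(x in B) (laplace_pdf s x)%:E)%E.

Definition bernoulli_law d (Omega : measurableType d) (R : realType)
    (P : probability Omega R) (X : {RV P >-> bool}) (p : R) : Prop :=
  forall B : set bool, distribution P X B = bernoulli_prob p B.

Definition mutually_independent d (Omega : measurableType d) (R : realType)
    (P : probability Omega R) (I : finType) (G : I -> set_system Omega) : Prop :=
  forall (J : {set I}) (E : I -> set Omega),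
    (forall i, i \in J -> G i (E i)) ->
    P (\bigcap_(i in [set` J]) E i) = (\prod_(i in J) P (E i))%E.

(* The sources of randomness of one run of the algorithm with sample size [m]
   on a stream of length [T]. *)
Variant source (m T : nat) : Type :=
  | Sample | Init of 'I_m | Resample of 'I_T | Noise.

Arguments Sample {m T}.
Arguments Init {m T}.
Arguments Resample {m T}.
Arguments Noise {m T}.

Section SourceFinite.
Variables m T : nat.

Definition source_code (s : source m T) : option (option ('I_m + 'I_T)) :=
  match s with
  | Sample => None
  | Noise => Some None
  | Init i => Some (Some (inl i))
  | Resample t => Some (Some (inr t))
  end.

Definition source_decode (c : option (option ('I_m + 'I_T))) : source m T :=
  match c with
  | None => Sample
  | Some None => Noise
  | Some (Some (inl i)) => Init i
  | Some (Some (inr t)) => Resample t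
  end.

Lemma source_codeK : cancel source_code source_decode.
Proof. by case. Qed.

HB.instance Definition _ := Finite.copy (source m T) (can_type source_codeK).

End SourceFinite.

(* [sample] is an arbitrary ordering of a uniformly random [m]-subset of [U];
   no law is imposed on the ordering.  [resampled_bit t] is the fresh coin of
   time step [t]; at most one bit is re-sampled at each step, as the entries
   of [sample] are pairwise distinct. *)
Record obde_randomness d (Omega : measurableType d) (R : realType)
    (P : probability Omega R) (U : finType) (m T : nat) (eps : R) : Type :=
  ObdeRandomness {
    sample : Omega -> m.-tuple U;
    init_bit : 'I_m -> {RV P >-> bool};
    resampled_bit : 'I_T -> {RV P >-> bool};
    noise : {RV P >-> R};
    sample_measurable :
      forall x : m.-tuple U, measurable (sample @^-1` [set x]);
    sample_distinct : forall w, uniq (sample w);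
    sample_uniform : forall A : {set U}, #|A| = m ->
      P [set w | sample w =i A] = (('C(#|U|, m)%:R)^-1)%:E;
    init_bit_law : forall i,
      bernoulli_law (init_bit i) (2^-1 * (1 - tanh (eps / 2)));
    resampled_bit_law : forall t,
      bernoulli_law (resampled_bit t) (2^-1 * (1 + tanh (eps / 2)));
    noise_law : laplace_law noise (eps * m%:R)^-1;
    randomness_independent :
      mutually_independent P (fun s : source m T =>
        match s with
        | Sample => preimage_set_system setT sample setT
        | Init i => preimage_set_system setT (init_bit i) measurable
        | Resample t => preimage_set_system setT (resampled_bit t) measurable
        | Noise => preimage_set_system setT noise measurable
        end)
  }.

Definition obde_step (U : finType) (m : nat) (M : m.-tuple U)
    (b : {ffun 'I_m -> bool}) (x : U * bool) : {ffun 'I_m -> bool} :=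
  [ffun i => if x.1 == tnth M i then x.2 else b i].

Section Estimator.
Context d (Omega : measurableType d) (R : realType) (P : probability Omega R).
Context (U : finType) (m T : nat) (eps : R).

Definition obde_bits (X : obde_randomness P U m T eps) (S : T.-tuple U)
    (w : Omega) : {ffun 'I_m -> bool} :=
  foldl (obde_step (sample X w)) [ffun i => init_bit X i w]
    [seq (tnth S t, resampled_bit X t w) | t <- enum 'I_T].

Definition obde (X : obde_randomness P U m T eps) (S : T.-tuple U)
    (w : Omega) : R :=
  (tanh (eps / 2))^-1 *
    (m%:R^-1 * (\sum_(i < m) (obde_bits X S w i)%:R)
     - 2^-1 + 2^-1 * tanh (eps / 2))
  + noise X w.

End Estimator.

Definition density (R : realType) (U : finType) (S : seq U) : R :=
  #|[pred u | u \in S]|%:R / #|U|%:R.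

(* Main.v *)
Require Import Defs.
From HB Require Import structures.
From mathcomp Require Import all_boot all_order all_algebra.
From mathcomp Require Import all_classical all_reals all_analysis.
From mathcomp Require Import measurable_realfun ring lra.
Set Implicit Arguments.
Unset Strict Implicit.
Unset Printing Implicit Defensive.
Import Order.TTheory GRing.Theory Num.Theory.
Import numFieldNormedType.Exports.
Local Open Scope classical_set_scope.
Local Open Scope ring_scope.

(** Given the sample [M], the final bits are independent, the bit of a user [u]
    being 1 with probability [p u] = (1 -+ tanh (eps / 2)) / 2 according to
    whether [u] is absent from or present in the stream.  Hence the moment
    generating function of the number of 1s is the expectation of a product
    [\prod_(u in M) g u] with [g >= 0]; for uniform sampling without replacement
    this is a normalised elementary symmetric polynomial, which by Maclaurin's
    inequality is at most the [m]-th power of the mean of [g].  So the number of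
    1s has Chernoff tails at least as good as for [m] independent bits with the
    mean bias, whose centred value is an affine image of the density.  The
    Laplace noise has an exponential tail, and a union bound concludes. *)

(** * Elementary symmetric polynomials and Maclaurin's inequality *)

(** Double counting: removing the marked point is a bijection from sets with a marked element to
    smaller sets with a marked outside point. *)
Lemma sum_cardS_remove (V : nmodType) (U : finType) (m : nat)
    (F : U -> {set U} -> V) :
  \sum_(A : {set U} | #|A| == m.+1) \sum_(u in A) F u (A :\ u) =
  \sum_(A : {set U} | #|A| == m) \sum_(u | u \notin A) F u A.
Proof.
rewrite (exchange_big_dep predT) //= [RHS](exchange_big_dep predT) //=.
apply: eq_bigr => u _.
rewrite (reindex_onto (fun A => u |: A) (fun A => A :\ u)) /=; last first.
  by move=> A /andP[_ uA]; rewrite finset.setD1K.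
rewrite (eq_bigl (fun A : {set U} => (#|A| == m) && (u \notin A))); last first.
  move=> A; rewrite finset.setU11 andbT; have [uA|uA] := boolP (u \in A).
    rewrite andbF; apply/negbTE/negP => /andP[_ /eqP e].
    by move: uA; rewrite -e !inE eqxx.
  by rewrite finset.setU1K // eqxx cardsU1 uA eqSS andbT.
by apply: eq_bigr => A /andP[_ uA]; rewrite finset.setU1K.
Qed.

Section ElementarySymmetric.
Variables (R : realFieldType) (U : finType) (g : U -> R).
Hypothesis g_ge0 : forall u, 0 <= g u.

Definition elem_sym m : R := \sum_(A : {set U} | #|A| == m) \prod_(u in A) g u.

(** Each product over an [m.+1]-set arises once for every choice of the factor split off. *)
Lemma elem_sym_recl m :
  m.+1%:R * elem_sym m.+1 =
  \sum_(A : {set U} | #|A| == m) (\prod_(u in A) g u) * \sum_(v | v \notin A) g v.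
Proof.
rewrite /elem_sym big_distrr /=.
under [RHS]eq_bigr => A _.
  rewrite big_distrr /=; over.
rewrite -(sum_cardS_remove _ (fun v A => (\prod_(u in A) g u) * g v)).
apply: eq_bigr => A /eqP cA.
rewrite -cA -sum1_card natr_sum big_distrl /=.
by apply: eq_bigr => u uA; rewrite mul1r mulrC (big_setD1 u uA).
Qed.

Lemma sum_swap_ge0 (B : {set U}) :
  0 <= \sum_(u | u \notin B) \sum_(v | v \notin B) g u * (g u - g v).
Proof.
rewrite -(pmulrn_lge0 _ (ltn0Sn 1)) mulr2n.
rewrite [X in _ + X]exchange_big -big_split /= sumr_ge0 // => u _.
rewrite -big_split /= sumr_ge0 // => v _.
rewrite (_ : _ + _ = (g u - g v) ^+ 2) ?sqr_ge0 //; ring.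
Qed.

(* The terms with [v] in [A] cancel out.  The rest is regrouped according to
   [B = A :\ u], where the sum over [u] and [v] outside [B] becomes half a sum of
   squares upon exchanging [u] and [v]. *)
Lemma elem_sym_boundary_ge0 m :
  0 <= \sum_(A : {set U} | #|A| == m) (\prod_(w in A) g w) *
    \sum_(u in A) \sum_v (g u - g v).
Proof.
under eq_bigr => A _.
  rewrite (_ : \sum_(u in A) _ =
    \sum_(u in A) \sum_(v | v \notin A) (g u - g v)); last first.
    transitivity (\sum_(u in A) (\sum_(v in A) (g u - g v)) +
      \sum_(u in A) \sum_(v | v \notin A) (g u - g v)).
      by rewrite -big_split /=; apply: eq_bigr => u _; rewrite [LHS](bigID (mem A)).
    rewrite (_ : \sum_(u in A) _ = 0) ?add0r //.
    apply: (mulIf (negbT (@pnatr_eq0 R 2))).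
    rewrite mul0r mulr_natr mulr2n {2}exchange_big -big_split /=.
    apply: big1 => u _; rewrite -big_split /=; apply: big1 => v _; ring.
  rewrite big_distrr /=; over.
case: m => [|m].
  by rewrite big1 // => A /eqP /cards0_eq ->; rewrite big_set0.
pose G u (B : {set U}) :=
  (\prod_(w in B) g w) * \sum_(v | v \notin B) g u * (g u - g v).
rewrite (eq_bigr (fun A : {set U} => \sum_(u in A) G u (A :\ u))).
  rewrite sum_cardS_remove sumr_ge0 // => B _.
  by rewrite -big_distrr /= mulr_ge0 ?prodr_ge0 ?sum_swap_ge0 //.
move=> A _; apply: eq_bigr => u uA; rewrite /G.
rewrite [X in _ = _ * X](bigD1 u) ?finset.setD11 //=.
rewrite subrr mulr0 add0r -big_distrr /= (big_setD1 u uA) /= mulrCA mulrA.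
congr (_ * _); apply: eq_bigl => v; rewrite !inE negb_and negbK.
by have [->|] := eqVneq v u; rewrite ?uA //= andbT.
Qed.

(** The difference of the two sides is exactly the sum in [elem_sym_boundary_ge0]. After division by
    binomials, this is the induction step of Maclaurin's inequality. *)
Lemma elem_symS_le m : (m <= #|U|)%N ->
  #|U|%:R * (m.+1%:R * elem_sym m.+1) <= (#|U| - m)%:R * (elem_sym m * \sum_u g u).
Proof.
move=> mU; rewrite -subr_ge0; move: (elem_sym_boundary_ge0 m); congr (0 <= _).
rewrite elem_sym_recl natrB // /elem_sym [X in _ * X - _]big_distrl /= !big_distrr /=.
rewrite -sumrB; apply: eq_bigr => A /eqP cA.
have -> : \sum_(u in A) \sum_v (g u - g v) =
    #|U|%:R * \sum_(u in A) g u - m%:R * \sum_u g u.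
  under eq_bigr do rewrite sumrB sumr_const -mulr_natl.
  by rewrite sumrB sumr_const cA -mulr_sumr -[_ *+ m]mulr_natl.
rewrite [\sum_u g u](bigID (mem A)) /=; ring.
Qed.

(* Maclaurin's inequality, in its comparison with the arithmetic mean. *)
Lemma elem_sym_le m : (m <= #|U|)%N ->
  elem_sym m / 'C(#|U|, m)%:R <= (#|U|%:R^-1 * \sum_u g u) ^+ m.
Proof.
elim: m => [_|m IHm mU].
  rewrite /elem_sym bin0 divr1 expr0 (big_pred1 finset.set0) ?big_set0 // => A.
  by rewrite cards_eq0.
rewrite exprSr; apply: le_trans (ler_wpM2r _ (IHm (ltnW mU))); last first.
  by rewrite mulr_ge0 ?invr_ge0 ?ler0n ?sumr_ge0.
have U0 : 0 < #|U|%:R :> R by rewrite ltr0n (leq_trans _ mU).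
have C0 : 0 < 'C(#|U|, m)%:R :> R by rewrite ltr0n bin_gt0 ltnW.
have C1 : 0 < 'C(#|U|, m.+1)%:R :> R by rewrite ltr0n bin_gt0.
have d0 : 0 < (#|U| - m)%:R :> R by rewrite ltr0n subn_gt0.
have m0 : 0 < m.+1%:R :> R by rewrite ltr0n.
have CE : m.+1%:R * 'C(#|U|, m.+1)%:R = (#|U| - m)%:R * 'C(#|U|, m)%:R :> R.
  by rewrite -!natrM mul_bin_left.
have := elem_symS_le (ltnW mU).
rewrite ler_pdivrMr // => h.
rewrite -(ler_pM2l m0) [leRHS]mulrCA CE -(ler_pM2l U0).
apply: (le_trans h); rewrite le_eqVlt; apply/orP; left; apply/eqP.
by field; rewrite ?gt_eqF.
Qed.

End ElementarySymmetric.

(** * Chernoff bound for bits of users sampled without replacement *)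

Lemma expR_le_quadratic (R : realType) (x : R) :
  `|x| <= 2^-1 -> expR x <= 1 + x + 2 * x ^+ 2.
Proof.
rewrite ler_norml => /andP[x1 x2].
have h : 1 - x <= expR (- x) by exact: expR_ge1Dx.
have y0 : 0 < 1 - x by lra.
have : expR x <= (1 - x)^-1.
  by rewrite -[x in expR x]opprK expRN lef_pV2 ?posrE // (lt_le_trans y0).
move=> /le_trans; apply.
(* Here [(1 + x + 2 * x ^+ 2) * (1 - x)] equals [1 + x ^+ 2 * (1 - 2 * x)], which is at least 1 as
   [x] is at most 1/2. *)
rewrite -[X in X <= _]mul1r ler_pdivrMr //.
have : 0 <= x ^+ 2 * (1 - 2 * x) by rewrite mulr_ge0 ?sqr_ge0 //; lra.
nra.
Qed.

Lemma bernoulli_mgf_le (R : realType) (p l : R) : 0 <= p <= 1 -> `|l| <= 2^-1 ->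
  (1 - p) + p * expR l <= expR (p * l + 2 * l ^+ 2).
Proof.
move=> /andP[p0 p1] /expR_le_quadratic h.
apply: le_trans (expR_ge1Dx _).
have : p * expR l <= p * (1 + l + 2 * l ^+ 2) by rewrite ler_wpM2l.
have := sqr_ge0 l; nra.
Qed.

Section SampledBernoulli.
Variables (R : realType) (U : finType) (m : nat).
Hypothesis mU : (m <= #|U|)%N.
Variable pr : m.-tuple U -> R.
Hypothesis pr_ge0 : forall M, 0 <= pr M.
Hypothesis pr_uniq : forall M : m.-tuple U, ~~ uniq M -> pr M = 0.
Hypothesis pr_uniform : forall A : {set U}, #|A| = m ->
  \sum_(M : m.-tuple U | [set u in M]%SET == A) pr M = 'C(#|U|, m)%:R^-1.

(* [pr] is the law of the ordered sample: only the law of the underlying set is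
   constrained. *)
Lemma sampled_prod_le (g : U -> R) : (forall u, 0 <= g u) ->
  \sum_M pr M * \prod_(i < m) g (tnth M i) <= (#|U|%:R^-1 * \sum_u g u) ^+ m.
Proof.
move=> g0; apply: le_trans (elem_sym_le g0 mU).
rewrite (bigID (fun M : m.-tuple U => uniq M)) /= [X in _ + X]big1 ?addr0; last first.
  by move=> M /pr_uniq ->; rewrite mul0r.
rewrite (partition_big (fun M : m.-tuple U => [set u in M]%SET)
  (fun A : {set U} => #|A| == m)) /=; last first.
  by move=> M uM; rewrite cardsE (card_uniqP uM) size_tuple.
rewrite /elem_sym big_distrl /= le_eqVlt; apply/orP; left; apply/eqP.
apply: eq_bigr => A /eqP cA; rewrite -(pr_uniform cA) big_distrr /=.
rewrite (big_mkcond (fun M => _ == A)) (big_mkcond (fun M => _ && _)) /=.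
apply: eq_bigr => M _.
case: eqP => [<-|]; last by rewrite andbF.
rewrite andbT; case: ifPn => uM; last by rewrite pr_uniq // mulr0.
rewrite mulrC; congr (_ * _).
rewrite (eq_bigl (mem M)); last by move=> u; rewrite !inE.
by rewrite -big_uniq // big_tuple.
Qed.

Variable p : U -> R.
Hypothesis p01 : forall u, 0 <= p u <= 1.

(** The joint law of ordered sample and final bits: given [M], the bits are independent with biases
    [p (tnth M i)]. *)
Definition bit_weight (M : m.-tuple U) (v : {ffun 'I_m -> bool}) : R :=
  pr M * \prod_(i < m) (if v i then p (tnth M i) else 1 - p (tnth M i)).

Lemma bit_weight_ge0 M v : 0 <= bit_weight M v.
Proof.
rewrite mulr_ge0 // prodr_ge0 // => i _.
by have /andP[? ?] := p01 (tnth M i); case: ifP => // _; rewrite subr_ge0.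
Qed.

Let pbar := #|U|%:R^-1 * \sum_u p u.

Let hits (v : {ffun 'I_m -> bool}) : R := \sum_(i < m) (v i)%:R.

Hypothesis m_gt0 : (0 < m)%N.

Lemma sampled_bits_mgf_le (l : R) : `|l| <= 2^-1 ->
  \sum_M \sum_v bit_weight M v * expR (l * (hits v - m%:R * pbar)) <=
  expR (m%:R * (2 * l ^+ 2)).
Proof.
move=> hl.
have U0 : 0 < #|U|%:R :> R by rewrite ltr0n (leq_trans m_gt0).
pose g u := 1 - p u + p u * expR l.
have g0 u : 0 <= g u.
  by have /andP[? ?] := p01 u; rewrite addr_ge0 ?subr_ge0 // mulr_ge0 ?expR_ge0.
under eq_bigr => M _.
  rewrite (_ : \sum_v _ = expR (- (l * (m%:R * pbar))) *
      (pr M * \prod_(i < m) g (tnth M i))).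
    over.
  (* [g u] is the moment generating function of one bit; distributing the product over the two
     values of each bit recovers the sum over bit vectors [v]. *)
  have -> : \prod_(i < m) g (tnth M i) = \prod_(i < m) \sum_b
      (if b then p (tnth M i) else 1 - p (tnth M i)) * expR (l * b%:R).
    by apply: eq_bigr => i _; rewrite big_bool /= mulr1 mulr0 expR0 mulr1 addrC.
  rewrite bigA_distr_bigA /= !big_distrr /=; apply: eq_bigr => v _.
  rewrite mulrBr expRD mulrC big_split /= /bit_weight.
  have -> : expR (l * hits v) = \prod_(i < m) expR (l * (v i)%:R).
    by rewrite /hits mulr_sumr expR_sum.
  by ring.
rewrite -mulr_sumr.
have /(ler_wpM2l (expR_ge0 (- (l * (m%:R * pbar))))) := sampled_prod_le g0.
move=> /le_trans; apply.
(* As [g] is affine in [p], its mean is the moment generating function of a Bernoulli variable of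
   parameter [pbar]. *)
have gE : #|U|%:R^-1 * \sum_u g u = (1 - pbar) + pbar * expR l.
  rewrite /g big_split /= sumrB sumr_const cardE -cardT -mulr_suml /pbar.
  by field; rewrite gt_eqF.
have pbar01 : 0 <= pbar <= 1.
  apply/andP; split.
    by rewrite mulr_ge0 ?invr_ge0 ?ler0n ?sumr_ge0 // => u _; case/andP: (p01 u).
  rewrite ler_pdivrMl // mulr1 -sum1_card natr_sum ler_sum // => u _.
  by case/andP: (p01 u).
have hp := bernoulli_mgf_le pbar01 hl.
rewrite gE; apply: (@le_trans _ _ (expR (- (l * (m%:R * pbar))) *
  expR (pbar * l + 2 * l ^+ 2) ^+ m)).
  rewrite ler_wpM2l ?expR_ge0 // lerXn2r ?nnegrE ?expR_ge0 //.
  rewrite -gE mulr_ge0 ?invr_ge0 ?ler0n ?sumr_ge0 //.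
by rewrite -expRM_natl -expRD ler_expR le_eqVlt; apply/orP; left; apply/eqP; ring.
Qed.

Lemma sampled_bits_tail (t : R) : 0 < t <= 1 ->
  \sum_M \sum_(v | m%:R * t <= `|hits v - m%:R * pbar|) bit_weight M v <=
  2 * expR (- (m%:R * t ^+ 2 / 8)).
Proof.
(* [t / 4] minimises the exponent [2 * l ^+ 2 - l * t], with minimum [- t ^+ 2 / 8]. *)
move=> /andP[t0 t1]; pose l := t / 4.
have l0 : 0 < l by rewrite divr_gt0.
have hl : `|l| <= 2^-1 by rewrite ger0_norm ?ltW // /l; lra.
have hl' : `|- l| <= 2^-1 by rewrite normrN.
set Z := expR (- (l * (m%:R * t))).
(* Markov's inequality for both tails at once: on the deviation event one of the two exponentials,
   scaled by [Z], is at least 1. *)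
apply: (@le_trans _ _ (\sum_M \sum_v
    (Z * (bit_weight M v * expR (l * (hits v - m%:R * pbar))) +
     Z * (bit_weight M v * expR (- l * (hits v - m%:R * pbar)))))).
  apply: ler_sum => M _; rewrite big_mkcond /=; apply: ler_sum => v _.
  have w0 := bit_weight_ge0 M v.
  case: ifPn => [|_]; last by rewrite addr_ge0 ?(mulr_ge0 _ (mulr_ge0 _ _)) ?expR_ge0.
  set x := hits v - _ => hx.
  rewrite ![Z * (_ * _)]mulrCA -mulrDr ler_peMr // -!expRD.
  have [x0|x0] := leP 0 x.
    have : 0 <= l * (x - m%:R * t).
      by rewrite mulr_ge0 ?(ltW l0) // subr_ge0 -(ger0_norm x0).
    by move=> h; rewrite ler_wpDr ?expR_ge0 // -[leLHS]expR0 ler_expR; lra.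
  have : 0 <= l * (- x - m%:R * t).
    by rewrite mulr_ge0 ?(ltW l0) // subr_ge0 -(ltr0_norm x0).
  by move=> h; rewrite ler_wpDl ?expR_ge0 // -[leLHS]expR0 ler_expR; lra.
under eq_bigr do rewrite big_split /= -!mulr_sumr.
rewrite big_split /= -!mulr_sumr -mulrDr.
have := lerD (sampled_bits_mgf_le hl) (sampled_bits_mgf_le hl').
move=> /(ler_wpM2l (expR_ge0 (- (l * (m%:R * t))))) /le_trans; apply.
rewrite sqrrN -mulr2n -[_ *+ 2]mulr_natl mulrCA -expRD.
rewrite ler_wpM2l // ler_expR le_eqVlt; apply/orP; left; apply/eqP.
by rewrite /l; field.
Qed.

End SampledBernoulli.

(** * Tails of the Laplace distribution *)

Lemma continuous_laplace_pdf (R : realType) (s : R) :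
  continuous (laplace_pdf s : R -> R).
Proof.
move=> x; apply: cvgM; first exact: cvg_cst.
apply: continuous_comp; last exact: continuous_expR.
apply: cvgMl; apply: cvgN; exact: norm_continuous.
Qed.

Lemma integral_laplace_pdf_right (R : realType) (s a : R) : 0 < s -> 0 < a ->
  (\int[lebesgue_measure]_(x in `[a, +oo[) (laplace_pdf s x)%:E =
   (2^-1 * expR (- (a / s)))%:E)%E.
Proof.
move=> s0 a0.
(* An antiderivative of the density on the positive half-line; [a > 0] keeps away from the kink at
   0. *)
pose F (x : R) : R := - 2^-1 * expR (- s^-1 * x).
have dF (x : R) : is_derive x 1 F (2^-1 * s^-1 * expR (- s^-1 * x)).
  apply: is_derive_eq.
  rewrite -[LHS]/(- 2^-1 * (expR (- s^-1 * x) * (- s^-1 * 1))); ring.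
have cF : continuous F.
  move=> x; apply: differentiable_continuous; apply/derivable1_diffP.
  exact: ex_derive.
rewrite (@ge0_continuous_FTC2y R (laplace_pdf s) F a 0).
- rewrite /F sub0e -EFinN; congr EFin.
  by rewrite mulNr opprK mulNr mulrC [s^-1 * a]mulrC mulrC.
- move=> x _; rewrite mulr_ge0 ?expR_ge0 // invr_ge0 mulr_ge0 //; exact: ltW.
- by apply: continuous_subspaceT => x; exact: continuous_laplace_pdf.
- rewrite /F -(mulr0 (- 2^-1)); apply: cvgMr.
  rewrite (_ : (fun x => _) = (fun z => expR (- z)) \o (fun z => s^-1 * z)).
    apply: (@cvg_comp _ _ _ _ _ _ (pinfty_nbhs R)); last exact: cvgr_expR.
    by apply: gt0_cvgMry; rewrite ?invr_gt0.
  by apply/funext => x /=; rewrite mulNr.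
- by move=> x _; exact: ex_derive.
- by apply: cvg_at_right_filter; exact: cF.
- move=> x; rewrite in_itv /= andbT => ax.
  rewrite derive1E derive_val /laplace_pdf gtr0_norm ?(lt_trans a0) //.
  by rewrite invfM mulNr mulNr [s^-1 * x]mulrC.
Qed.

Lemma integral_laplace_pdf_left (R : realType) (s a : R) : 0 < s -> 0 < a ->
  (\int[lebesgue_measure]_(x in `]-oo, (- a)%R]) (laplace_pdf s x)%:E =
   (2^-1 * expR (- (a / s)))%:E)%E.
Proof.
move=> s0 a0; rewrite ge0_integration_by_substitutionNy.
- rewrite -integral_laplace_pdf_right //; apply: eq_integral => x _ /=.
  by rewrite /laplace_pdf normrN.
- by apply: continuous_subspaceT => x; exact: continuous_laplace_pdf.
- move=> x _; rewrite mulr_ge0 ?expR_ge0 // invr_ge0 mulr_ge0 //; exact: ltW.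
Qed.

Lemma laplace_tail d (Omega : measurableType d) (R : realType)
    (P : probability Omega R) (X : {RV P >-> R}) (s a : R) :
  laplace_law X s -> 0 < s -> 0 < a ->
  (P [set w | (a <= `|X w|)%R] <= (expR (- (a / s)))%:E)%E.
Proof.
move=> hX s0 a0.
have mr : measurable (`[a, +oo[%classic : set R) by exact: measurable_itv.
have ml : measurable (`]-oo, (- a)%R]%classic : set R) by exact: measurable_itv.
rewrite (_ : [set _ | _] = X @^-1` `]-oo, (- a)%R] `|` X @^-1` `[a, +oo[); last first.
  apply/seteqP; split => w /=; rewrite !in_itv /= andbT ler_normr lerNr.
    by move=> /orP[]; [right|left].
  by move=> [->|->]; rewrite ?orbT.
have mX B : measurable B -> measurable (X @^-1` B).
  by move=> mB; rewrite -[X in measurable X]setTI; exact: measurable_funP.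
apply: le_trans (@measureU2 _ _ _ P _ _ (mX _ ml) (mX _ mr)) _.
rewrite -[leLHS]/(distribution P X _ + distribution P X _)%E !hX //.
rewrite integral_laplace_pdf_left // integral_laplace_pdf_right // -EFinD lee_fin.
lra.
Qed.

(** * Random variables with finitely many values *)

Section FinitelyValued.
Context d (Omega : measurableType d) (I : finType) (f : Omega -> I).
Hypothesis mf : forall i, measurable (f @^-1` [set i]).

Lemma finval_preimageE (B : set I) :
  f @^-1` B = \bigcup_(i in B) (f @^-1` [set i]).
Proof.
by apply/seteqP; split => [w Bw|w [i Bi]]; [by exists (f w)|by rewrite /= => ->].
Qed.

Lemma measurable_finval (B : set I) : measurable (f @^-1` B).
Proof. by rewrite finval_preimageE; exact: fin_bigcup_measurable. Qed.

Lemma measure_finval (R : realType) (P : {measure set Omega -> \bar R})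
    (B : pred I) :
  P [set w | B (f w)] = (\sum_(i | B i) P (f @^-1` [set i]))%E.
Proof.
rewrite -[X in P X]/(f @^-1` [set i | B i]) finval_preimageE.
rewrite measure_fin_bigcup //; [|exact: finite_finset|by move=> i j _ _ [w [/= <- <-]]].
rewrite (@fsbigE _ _ _ _ _ (enum B)) ?enum_uniq //=.
- rewrite big_enum_cond; apply: eq_bigl => i.
  by rewrite mem_setE; exact: andbb.
- by move=> i /=; rewrite mem_enum.
- by move=> i Bi; rewrite mem_enum unfold_in Bi.
Qed.

End FinitelyValued.

(** * The joint law of the sample and the final bits *)

Section LastTouch.
Variables (U : finType) (m T : nat) (M : m.-tuple U) (S : T.-tuple U).

Definition touch (u : U) (s : source m T) (t : 'I_T) : source m T :=
  if tnth S t == u then Resample t else s.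

(* The coin which the final value of bit [i] comes from. *)
Definition bit_source (i : 'I_m) : source m T :=
  foldl (touch (tnth M i)) (Init i) (enum 'I_T).

(** The boolean index records whether user [tnth M i] occurs in the stream, so one case analysis
    settles both the kind of coin and its bias. *)
Variant bit_source_spec (i : 'I_m) : source m T -> bool -> Prop :=
| BitInit : bit_source_spec i (Init i) false
| BitResample t of tnth S t = tnth M i : bit_source_spec i (Resample t) true.

Lemma bit_sourceP i :
  bit_source_spec i (bit_source i) (tnth M i \in S).
Proof.
have -> : (tnth M i \in S) = has (fun t => tnth S t == tnth M i) (enum 'I_T).
  apply/tnthP/hasP => [[t ->]|[t _ /eqP <-]]; last by exists t.
  by exists t; rewrite ?mem_enum.
(* Induction from the right end, since the last occurrence of the user decides the source. *)
rewrite /bit_source; elim/last_ind: (enum 'I_T) => [|l t IHl]; first by constructor.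
rewrite foldl_rcons has_rcons /touch -/(touch _).
by case: eqP => [e|_] /=; [constructor | exact: IHl].
Qed.

(** A time step involves a single user, so distinct sampled users never share a coin. This is what
    makes the final bits independent. *)
Lemma bit_source_inj : uniq M -> injective bit_source.
Proof.
move=> uM i j; case: (bit_sourceP i) => [|t ti]; case: (bit_sourceP j) => [|t' tj] //.
  by move=> [].
move=> [tt']; apply/(tuple_uniqP M uM); by rewrite -ti -tj tt'.
Qed.

End LastTouch.

Section Law.
Context d (Omega : measurableType d) (R : realType) (P : probability Omega R).
Context (U : finType) (m T : nat) (eps : R).
Variables (X : obde_randomness P U m T eps) (S : T.-tuple U).

(** [false] on [Sample] and [Noise] is a default value: [bit_source] returns only coins. *)
Definition bit_at (s : source m T) (w : Omega) : bool :=
  match s with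
  | Init i => init_bit X i w
  | Resample t => resampled_bit X t w
  | _ => false
  end.

Lemma obde_bitsE w i :
  obde_bits X S w i = bit_at (bit_source (sample X w) S i) w.
Proof.
rewrite /obde_bits /bit_source.
(* The invariant, for an arbitrary current array and source: bit [i] is the value of the coin
   currently recorded as its source. *)
move: [ffun _ => _] (Init i) (ffunE (fun i => init_bit X i w) i : _ = bit_at (Init i) w).
elim: (enum 'I_T) => [|t l IHl] b s /= bs //.
by apply: IHl; rewrite ffunE /touch /=; case: eqP.
Qed.

Definition bit_prob (u : U) : R :=
  2^-1 * (1 - tanh (eps / 2)) + (u \in S)%:R * tanh (eps / 2).

Lemma bernoulli_prob1 (p : R) (b : bool) : 0 <= p <= 1 ->
  bernoulli_prob p [set b] = (if b then p else 1 - p)%:E.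
Proof.
move=> p01; have mem1 a : (a \in [set b]) = (a == b) by apply/idP/eqP; rewrite in_setE.
rewrite bernoulli_probE // !diracE !mem1.
by case: b {mem1} => /=; rewrite ?mule1 ?mule0 ?adde0 ?add0e.
Qed.

Hypothesis th01 : 0 <= tanh (eps / 2) <= 1.

Lemma bit_prob_itv u : 0 <= bit_prob u <= 1.
Proof.
case/andP: th01 => th0 th1; rewrite /bit_prob.
by case: (u \in S); rewrite ?mul1r ?mul0r; apply/andP; split; lra.
Qed.

Lemma bit_at_law (M : m.-tuple U) i (b : bool) :
  P [set w | bit_at (bit_source M S i) w = b] =
  (if b then bit_prob (tnth M i) else 1 - bit_prob (tnth M i))%:E.
Proof.
rewrite -bernoulli_prob1 ?bit_prob_itv // /bit_prob.
case: (bit_sourceP M S i) => [|t ti] /=.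
  by rewrite mul0r addr0; exact: (init_bit_law X i [set b]).
rewrite mul1r (_ : _ + _ = 2^-1 * (1 + tanh (eps / 2))); last lra.
exact: (resampled_bit_law X t [set b]).
Qed.

(** Once [M] is fixed, so is the coin behind each bit. The event is then an intersection over
    distinct independent sources. *)
Lemma sample_bits_law (M : m.-tuple U) (v : {ffun 'I_m -> bool}) : uniq M ->
  P [set w | sample X w = M /\ obde_bits X S w = v] =
  (P (sample X @^-1` [set M]) *
   (\prod_(i < m) (if v i then bit_prob (tnth M i) else 1 - bit_prob (tnth M i)))%:E)%E.
Proof.
move=> uM.
pose J : {set source m T} := Sample |: [set bit_source M S i | i in 'I_m]%SET.
(* The event for a coin must be given as a function of the coin; by injectivity of [bit_source] its
   condition concerns just one bit, whence [EE]. *)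
pose E (s : source m T) : set Omega := match s with
  | Sample => sample X @^-1` [set M]
  | _ => bit_at s @^-1` [set b | forall i, bit_source M S i = s -> b = v i]
  end.
have EE i : E (bit_source M S i) = bit_at (bit_source M S i) @^-1` [set v i].
  have -> : [set v i] =
      [set b | forall j, bit_source M S j = bit_source M S i -> b = v j].
    apply/seteqP; split => b /=; last exact.
    by move=> -> j /(bit_source_inj uM) ->.
  by case: (bit_sourceP M S i).
have nS : Sample \notin [set bit_source M S i | i in 'I_m]%SET.
  by apply/imsetP => -[i _]; case: bit_sourceP.
have := @randomness_independent _ _ _ _ _ _ _ _ X J E.
rewrite [X in P X](_ : _ = [set w | sample X w = M /\ obde_bits X S w = v]); last first.
  apply/seteqP; split => w /=.
    move=> h; have sM : sample X w = M by apply: (h Sample); rewrite /= !inE eqxx.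
    split=> //; apply/ffunP => i; rewrite obde_bitsE sM.
    have := h (bit_source M S i); rewrite EE; apply.
    by rewrite /= !inE imset_f ?orbT.
  move=> [sM bv] s /=; rewrite !inE => /orP[/eqP -> //|/imsetP[i _ ->]].
  by rewrite EE /= -bv obde_bitsE sM.
move=> ->; last first.
  move=> s; rewrite !inE => /orP[/eqP ->|/imsetP[i _ ->]].
    by exists [set M]; rewrite //= setTI.
  case: (bit_sourceP M S i) => [|t _] /=; rewrite -[X in _ X]setTI; by eexists.
rewrite big_setU1 //= big_imset /=; last by move=> i j _ _; exact: bit_source_inj.
congr (_ * _)%E; rewrite -prodEFin; apply: eq_bigr => i _.
by rewrite -bit_at_law EE.
Qed.

End Law.

(** * Deviation of the estimator *)

(** The lower bound follows from [1 + x <= expR x] and its inverse. At [x = eps / 2] it makes the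
    signal of a bit at least [eps / 4]. *)
Lemma tanh_bounds (R : realType) (x : R) : 0 <= x <= 1 ->
  x / 2 <= tanh x <= 1.
Proof.
move=> /andP[x0 x1]; rewrite /tanh.
have a1 : 1 + x <= expR x := expR_ge1Dx x.
have b0 : 0 < expR (- x) := expR_gt0 _.
have a0 : 0 < expR x := expR_gt0 _.
have ab : expR x * expR (- x) = 1 by rewrite -expRD subrr expR0.
have b1 : expR (- x) * (1 + x) <= 1 by rewrite -[leRHS]ab [leRHS]mulrC ler_pM2l.
have D0 : 0 < expR x + expR (- x) by rewrite addr_gt0.
rewrite ler_pdivlMr // ler_pdivrMr //; apply/andP; split; last by lra.
have : expR (- x) * x >= 0 by rewrite mulr_ge0 // ltW.
have : (expR x - (1 + x)) * (1 - x / 2) >= 0 by rewrite mulr_ge0; lra.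
have : x * (1 - x) >= 0 by rewrite mulr_ge0; lra.
nra.
Qed.

Section Deviation.
Context d (Omega : measurableType d) (R : realType) (P : probability Omega R).
Context (U : finType) (m T : nat) (eps : R).
Variables (X : obde_randomness P U m T eps) (S : T.-tuple U).

Let run (w : Omega) := (sample X w, obde_bits X S w).

Lemma measurable_run x : measurable (run @^-1` [set x]).
Proof.
case: x => M v.
(* Fixing the sample fixes which coin each bit reads. *)
rewrite (_ : _ @^-1` _ = sample X @^-1` [set M] `&`
    \bigcap_(i in [set: 'I_m]) (bit_at X (bit_source M S i) @^-1` [set v i])).
  apply: measurableI; first exact: sample_measurable.
  apply: fin_bigcap_measurable; first exact: finite_finset.
  move=> i _; case: bit_sourceP => [|t _] /=;
    by rewrite -[X in measurable X]setTI; exact: measurable_funP.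
apply/seteqP; split => w /=.
  by move=> [sM bv]; split=> // i _; rewrite /= -bv obde_bitsE sM.
move=> [sM bv]; rewrite /run sM; congr pair; apply/ffunP => i.
by rewrite obde_bitsE sM; exact: bv.
Qed.

Lemma measurable_obde : measurable_fun setT (obde X S).
Proof.
apply: measurable_funD; last exact: measurable_funP.
move=> _ B mB; rewrite setTI.
exact: (measurable_finval measurable_run (fun x => B (_^-1 * (m%:R^-1 *
  (\sum_(i < m) (x.2 i)%:R) - 2^-1 + 2^-1 * tanh (eps / 2))))).
Qed.

Hypothesis th01 : 0 <= tanh (eps / 2) <= 1.
Hypothesis m_gt0 : (0 < m)%N.
Hypothesis mU : (m <= #|U|)%N.

Let q : R := 2^-1 * (1 - tanh (eps / 2)) + tanh (eps / 2) * density R S.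

(** Identifies the mean bias of the Chernoff bound with [q], the value of the bit average that the
    estimator's affine map sends to the density. *)
Lemma mean_bit_prob : #|U|%:R^-1 * \sum_u bit_prob eps S u = q.
Proof.
have U0 : #|U|%:R != 0 :> R by rewrite pnatr_eq0 -lt0n (leq_trans m_gt0).
rewrite /bit_prob big_split /= sumr_const -mulr_suml /q /density.
have -> : #|[pred u | u \in S]|%:R = \sum_u (u \in S)%:R :> R.
  rewrite -sum1_card natr_sum big_mkcond.
  by apply: eq_bigr => u _; rewrite inE; case: ifP.
rewrite -[_ *+ _]mulr_natr; by field.
Qed.

Lemma obde_bits_tail (t : R) : 0 < t <= 1 ->
  (P [set w | (m%:R * t <= `|\sum_(i < m) (obde_bits X S w i)%:R - m%:R * q|)%R]
   <= (2 * expR (- (m%:R * t ^+ 2 / 8)))%:E)%E.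
Proof.
move=> t01.
(* The law of the ordered sample, as real weights to which the finite Chernoff bound applies. *)
pose pr M := fine (P (sample X @^-1` [set M])).
have prE M : P (sample X @^-1` [set M]) = (pr M)%:E.
  by rewrite fineK // fin_num_measure //; exact: sample_measurable.
have pr0 M : 0 <= pr M by rewrite fine_ge0.
have pru (M : m.-tuple U) : ~~ uniq M -> pr M = 0.
  move=> uM; rewrite /pr (_ : _ @^-1` _ = set0) ?measure0 //.
  rewrite -subset0 => w /= sM; move: uM; rewrite -sM.
  by rewrite sample_distinct.
have prA (A : {set U}) : #|A| = m ->
    \sum_(M : m.-tuple U | [set u in M]%SET == A) pr M = 'C(#|U|, m)%:R^-1.
  move=> cA; apply/EFin_inj; rewrite -(sample_uniform X cA) -sumEFin.
  under eq_bigr do rewrite -prE.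
  rewrite -(measure_finval (sample_measurable X) P (fun M => [set u in M]%SET == A)).
  congr (P _); apply/seteqP; split => w /=.
    by move=> /eqP <- u; rewrite inE.
  by move=> h; apply/eqP/setP => u; rewrite inE h.
have := sampled_bits_tail mU pr0 pru prA (bit_prob_itv S th01) m_gt0 t01.
rewrite mean_bit_prob -lee_fin; apply: le_trans.
rewrite (measure_finval measurable_run P
  (fun x => m%:R * t <= `|\sum_(i < m) (x.2 i)%:R - m%:R * q|)).
rewrite pair_big_dep /= -sumEFin le_eqVlt; apply/orP; left; apply/eqP.
apply: eq_bigr => -[M v] _ /=.
have -> : run @^-1` [set (M, v)] = [set w | sample X w = M /\ obde_bits X S w = v].
  by apply/seteqP; split => w /= [sM bv]; rewrite /run ?sM ?bv.
rewrite /bit_weight EFinM.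
have [uM|uM] := boolP (uniq M); first by rewrite sample_bits_law // prE.
(* A tuple with repetitions has weight 0 and is never sampled. *)
rewrite pru // mul0e (_ : [set _ | _] = set0) ?measure0 //.
by rewrite -subset0 => w /= [sM _]; move: uM; rewrite -sM sample_distinct.
Qed.

Hypothesis eps_gt0 : 0 < eps.
Hypothesis th_gt0 : 0 < tanh (eps / 2).

Lemma obde_tail (alpha : R) : 0 < alpha < 1 ->
  (P [set w | (alpha <= `|obde X S w - density R S|)%R] <=
   (2 * expR (- (m%:R * (tanh (eps / 2) * alpha / 2) ^+ 2 / 8)) +
    expR (- (alpha / 2 * (eps * m%:R))))%:E)%E.
Proof.
move=> /andP[al0 al1]; have /andP[_ th1] := th01.
have m0 : 0 < m%:R :> R by rewrite ltr0n.
(* The error budget is halved between bits and noise: a count deviation of [m * t] becomes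
   [alpha / 2] after division by [m * tanh (eps / 2)]. *)
set t := tanh (eps / 2) * alpha / 2.
have t01 : 0 < t <= 1.
  rewrite /t divr_gt0 ?(mulr_gt0 th_gt0 al0) //=.
  have : tanh (eps / 2) * alpha <= 1 * 1 by rewrite ler_pM // ltW.
  by lra.
have s0 : 0 < (eps * m%:R)^-1 by rewrite invr_gt0 mulr_gt0.
have := laplace_tail (noise_law X) s0 (divr_gt0 al0 (ltr0n _ 2)).
have := obde_bits_tail t01.
rewrite invrK; set A := [set _ | _] => hA; set B := [set _ | _] => hB.
have mA : measurable A.
  exact: (measurable_finval measurable_run (fun x =>
    m%:R * t <= `|\sum_(i < m) (x.2 i)%:R - m%:R * q|)).
have mB : measurable B.
  rewrite (_ : B = (fun w => `|noise X w|) @^-1` `[alpha / 2, +oo[); last first.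
    by apply/seteqP; split => w; rewrite /B /= in_itv /= andbT.
  rewrite -[X in measurable X]setTI.
  by apply: measurableT_comp => //; exact: measurable_itv.
apply: (@le_trans _ _ (P (A `|` B))); last first.
  by apply: le_trans (@measureU2 _ _ _ P _ _ mA mB) _; rewrite EFinD leeD.
apply: le_measure; rewrite ?inE //.
- rewrite (_ : [set _ | _] =
     (fun w => `|obde X S w - density R S|) @^-1` `[alpha, +oo[); last first.
    by apply/seteqP; split => w; rewrite /= in_itv /= andbT.
  rewrite -[X in measurable X]setTI.
  have mg : measurable_fun setT (fun w => `|obde X S w - density R S|).
    apply: measurableT_comp; first exact: normr_measurable.
    by apply: measurable_funB; [exact: measurable_obde|exact: measurable_cst].
  by apply: mg => //; exact: measurable_itv.
- exact: measurableU.
(* By contraposition: off [A] and [B], both errors are below [alpha / 2]. *)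
move=> w /= hw; apply/or_asboolP/negPn/negP; rewrite negb_or.
rewrite /A /B /= !asboolb -!ltNge => /andP[hb hn].
move: hw; rewrite leNgt => /negP; apply.
set h := \sum_(i < m) _ in hb.
rewrite (_ : obde X S w - _ = (h - m%:R * q) / (m%:R * tanh (eps / 2)) + noise X w).
  apply: le_lt_trans (ler_normD _ _) _.
  rewrite [ltRHS]splitr ltr_leD ?(ltW hn) // normrM normfV.
  have D0 : 0 < m%:R * tanh (eps / 2) by exact: mulr_gt0.
  rewrite (gtr0_norm D0). rewrite ltr_pdivrMr //.
  apply: lt_le_trans hb _; rewrite le_eqVlt; apply/orP; left; apply/eqP.
  by rewrite /t; ring.
rewrite /obde -/h /q; field.
by rewrite !gt_eqF.
Qed.

End Deviation.

(** * The sample size and its order of growth *)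

(* The summand 2 keeps the bound below [beta] when [beta] is close to 1: each of
   the three exponential tails is at most [beta * expR (- 2) <= beta / 3]. *)
Definition obde_size (R : realType) (eps alpha beta : R) : nat :=
  (Num.truncn (512 * (ln beta^-1 + 2) / (eps ^+ 2 * alpha ^+ 2))).+1.

Lemma ln_inv_ge0 (R : realType) (beta : R) : 0 < beta < 1 -> 0 <= ln beta^-1.
Proof. by move=> /andP[b0 b1]; rewrite ln_ge0 // invf_ge1 // ltW. Qed.

Lemma obde_size_bigO (R : realType) :
  (fun p : R * R * R => (obde_size p.1.1 p.1.2 p.2)%:R : R^o) =O_ right_of_origin
    (fun p : R * R * R => (p.1.1 ^+ 2 * p.1.2 ^+ 2)^-1 * ln (p.2^-1) : R^o).
Proof.
apply/eqO_exP.
(* 1537 is [512 * 3 + 1]: near the origin [ln b^-1] and [D^-1] are at least 1, so the summand 2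
   costs two more logarithms and the successor at most one more [D^-1 * ln b^-1]. *)
exists 1537; first by rewrite ltr0n.
have e0 : 0 < expR (-1) :> R := expR_gt0 _.
exists ([set p | (0 < p.1 < 1) /\ (0 < p.2 < 1)], [set b | 0 < b < expR (-1)]).
  split => /=; last first.
    by apply: filterS2 (nbhs_right_gt 0) (nbhs_right_lt e0) => x /= -> ->.
  exists ([set a | 0 < a < 1], [set a | 0 < a < 1]) => //=.
  by split; apply: filterS2 (nbhs_right_gt 0) (nbhs_right_lt ltr01) => x /= -> ->.
move=> [[e a] b] /= [[/andP[e_gt0 e1] /andP[a0 a1]] /andP[b0 b1]].
have L1 : 1 <= ln b^-1.
  by rewrite lnV ?posrE // lerNr -[leRHS](@expRK R) ler_ln ?posrE // ltW.
set D := e ^+ 2 * a ^+ 2.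
have D0 : 0 < D by rewrite mulr_gt0 ?exprn_gt0.
have D1 : 1 <= D^-1.
  by rewrite invf_ge1 // /D mulr_ile1 ?exprn_ge0 ?exprn_ile1 ?ltW.
have LD : 1 <= D^-1 * ln b^-1 by rewrite mulr_ege1.
rewrite !ger0_norm ?ler0n //; last by rewrite (le_trans ler01).
rewrite /obde_size -natr1.
apply: (@le_trans _ _ (512 * (ln b^-1 + 2) / D + 1)).
  have L0 : 0 <= ln b^-1 + 2 by rewrite addr_ge0 // (le_trans _ L1).
  rewrite lerD2r truncn_le.
  exact: divr_ge0 (mulr_ge0 (ler0n _ _) L0) (ltW D0).
have : D^-1 * 2 <= D^-1 * (2 * ln b^-1).
  by rewrite ler_wpM2l ?invr_ge0 ?(ltW D0) //; lra.
move: LD; set x := D^-1; set L := ln _; lra.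
Qed.

Lemma obde_size_tail (R : realType) (eps alpha beta th : R) :
  0 < eps <= 2^-1 -> 0 < alpha < 1 -> 0 < beta < 1 -> eps / 4 <= th ->
  2 * expR (- ((obde_size eps alpha beta)%:R * (th * alpha / 2) ^+ 2 / 8)) +
    expR (- (alpha / 2 * (eps * (obde_size eps alpha beta)%:R))) <= beta.
Proof.
move=> /andP[e0 e1] /andP[a0 a1] b01 th1; case/andP: (b01) => b0 b1.
set m := (obde_size _ _ _)%:R.
set L := ln beta^-1 + 2.
have D0 : 0 < eps ^+ 2 * alpha ^+ 2 by rewrite mulr_gt0 ?exprn_gt0.
have hm : 512 * L <= m * (eps ^+ 2 * alpha ^+ 2).
  rewrite -ler_pdivrMr // ltW // /m /obde_size.
  exact: truncnS_gt.
have m0 : 0 <= m by rewrite ler0n.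
(* With [th >= eps / 4], the exponent is at least [m * (eps * alpha / 8) ^+ 2 / 8]; hence the
   constant 512, which is [8 ^ 2 * 8]. *)
have bits : L <= m * (th * alpha / 2) ^+ 2 / 8.
  have : (eps * alpha / 8) ^+ 2 <= (th * alpha / 2) ^+ 2.
    have ea : 0 <= eps * alpha / 8 by rewrite divr_ge0 ?mulr_ge0 ?ltW.
    have le8 : eps * alpha / 8 <= th * alpha / 2.
      by have := ler_wpM2r (ltW a0) th1; lra.
    by rewrite lerXn2r ?nnegrE // (le_trans ea le8).
  move=> /(ler_wpM2l m0); nra.
(* As [eps * alpha <= 1], the exponent, linear in [eps * alpha], dominates the quadratic one in
   [hm]. *)
have noise : L <= alpha / 2 * (eps * m).
  have ea : eps * alpha <= 1 by rewrite mulr_ile1 ?ltW //; lra.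
  have : (eps * alpha) * (eps * alpha) <= eps * alpha.
    by rewrite ler_piMl // mulr_ge0 ?ltW.
  have ea0 : 0 <= m * (eps * alpha) by rewrite !mulr_ge0 ?ltW.
  move=> /(ler_wpM2l m0); nra.
have tail x : L <= x -> expR (- x) <= beta / 3.
  move=> Lx; apply: (@le_trans _ _ (expR (- L))); first by rewrite ler_expR lerN2.
  rewrite /L opprD expRD lnV ?posrE // opprK lnK ?posrE //.
  rewrite ler_wpM2l ?(ltW b0) // expRN lef_pV2 ?posrE ?expR_gt0 //.
  by have := expR_ge1Dx (2 : R); lra.
have := tail _ bits; have := tail _ noise; lra.
Qed.

Theorem theorem4p6 (R : realType) :
  exists m : R -> R -> R -> nat,
    (fun p : R * R * R => (m p.1.1 p.1.2 p.2)%:R : R^o) =O_ right_of_origin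
      (fun p : R * R * R => (p.1.1 ^+ 2 * p.1.2 ^+ 2)^-1 * ln (p.2^-1) : R^o) /\
    forall eps alpha beta : R,
      0 < eps <= 2^-1 -> 0 < alpha < 1 -> 0 < beta < 1 ->
      (0 < m eps alpha beta)%N /\
      forall U : finType, (m eps alpha beta <= #|U|)%N ->
      forall (T : nat) (S : T.-tuple U)
             (d : measure_display) (Omega : measurableType d)
             (P : probability Omega R)
             (X : obde_randomness P U (m eps alpha beta) T eps),
        (P [set w | (alpha <= `|obde X S w - density R S|)%R] <= beta%:E)%E.
Proof.
exists (@obde_size R); split; first exact: obde_size_bigO.
move=> eps alpha beta he ha hb; split=> // U mU T S d Omega P X.
have /andP[e0 e1] := he.
have e2 : 0 <= eps / 2 <= 1 by apply/andP; split; lra.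
have /andP[th0 th1] := tanh_bounds e2.
have th_gt0 : 0 < tanh (eps / 2) by apply: lt_le_trans th0; lra.
have th01 : 0 <= tanh (eps / 2) <= 1 by rewrite ltW.
apply: (le_trans (obde_tail X S th01 (ltn0Sn _) mU e0 th_gt0 ha)).
by rewrite lee_fin obde_size_tail //; apply: le_trans th0; lra.
Qed.
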